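(* For all $n \ge 2$, $$|S_n(132, 654213, 2341)| = 5F_{n+6} + F_{n+4} - 4\binom{n+1}{4} - 7\binom{n+1}{3} - 5\binom{n+1}{2} - 27\binom{n+1}{1} - 8.$$ Moreover, the generating function $f(x) = \sum_{n=0}^\infty |S_n(132, 654213, 2341)|\, x^n$ is given by $$f(x) = \frac{2x^8 - x^7 - x^6 - 5x^5 - x^4 + 8x^3 - 10x^2 + 5x - 1}{(x^2 + x - 1)(1 - x)^5}.$$
   Context: Permutations of $[n]$ are written in one-line notation, and $S_n$ denotes the set of them. A permutation $\pi\in S_n$ contains $\sigma\in S_m$ if there are indices $i_1<\dots<i_m$ such that for all $a,b$, $\pi(i_a)<\pi(i_b)$ iff $\sigma(a)<\sigma(b)$; otherwise $\pi$ avoids $\sigma$. For a set $R$ of permutations, $S_n(R)$ is the set of $\pi\in S_n$ avoiding every element of $R$; $S_0(R)$ consists of the empty permutation only. $F_n$ denotes the Fibonacci numbers with $F_0=0$, $F_1=F_2=1$, $F_n=F_{n-1}+F_{n-2}$. *)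

(* Defs.v *)
From HB Require Import structures.
From mathcomp Require Import all_boot all_order all_fingroup all_algebra.

Set Implicit Arguments.
Unset Strict Implicit.
Unset Printing Implicit Defensive.

Import GRing.Theory.

(* Permutations of [n] are elements of {perm 'I_n}: positions and values are
   shifted from 1..n to 0..n-1. *)

Definition contains (n m : nat) (p : {perm 'I_n}) (s : {perm 'I_m}) : bool :=
  [exists f : {ffun 'I_m -> 'I_n},
     [forall a : 'I_m, forall b : 'I_m, (a < b) ==> (f a < f b)] &&
     [forall a : 'I_m, forall b : 'I_m, (p (f a) < p (f b)) == (s a < s b)]].

Definition avoids (n m : nat) (p : {perm 'I_n}) (s : {perm 'I_m}) : bool :=
  ~~ contains p s.

Definition pattern : Type := {m : nat & {perm 'I_m}}.

Definition avoiders (n : nat) (R : seq pattern) : {set {perm 'I_n}} :=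
  [set p : {perm 'I_n} | all (fun s : pattern => avoids p (tagged s)) R].

(* One-line notation, with the usual entries 1..n. *)
Definition one_line (n : nat) (p : {perm 'I_n}) : seq nat :=
  [seq (p i).+1 | i <- enum 'I_n].

Definition word_fun (m : nat) (w : seq nat) (i : 'I_m.+1) : 'I_m.+1 :=
  inord (nth 0 w i).-1.

Section Word.
Variables (m : nat) (w : seq nat).
Hypothesis wP : perm_eq w (iota 1 m.+1).

Lemma word_size : size w = m.+1.
Proof. by rewrite (perm_size wP) size_iota. Qed.

Lemma word_nth (i : 'I_m.+1) : 0 < nth 0 w i <= m.+1.
Proof.
have : nth 0 w i \in w by rewrite mem_nth // word_size.
by rewrite (perm_mem wP) mem_iota add1n ltnS.
Qed.

Lemma word_funE (i : 'I_m.+1) : (word_fun w i).+1 = nth 0 w i.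
Proof.
have /andP[w_gt0 w_le] := word_nth i.
by rewrite inordK ?prednK.
Qed.

Lemma word_fun_inj : injective (@word_fun m w).
Proof.
move=> i j /(congr1 (fun k : 'I_m.+1 => k.+1)); rewrite !word_funE => eq_ij.
have uniq_w : uniq w by rewrite (perm_uniq wP) iota_uniq.
by apply/val_inj/(uniqP 0 uniq_w); rewrite ?inE ?word_size ?ltn_ord.
Qed.

Definition word_perm : {perm 'I_m.+1} := perm word_fun_inj.

Lemma one_line_word_perm : one_line word_perm = w.
Proof.
apply: (@eq_from_nth _ 0); rewrite /one_line size_map size_enum_ord ?word_size //.
move=> i lt_im; rewrite (nth_map ord0) ?size_enum_ord // permE word_funE.
by rewrite nth_enum_ord.
Qed.
End Word.

Definition p132 : pattern :=
  Tagged (fun m => {perm 'I_m}) (@word_perm 2 [:: 1; 3; 2] isT).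
Definition p2341 : pattern :=
  Tagged (fun m => {perm 'I_m}) (@word_perm 3 [:: 2; 3; 4; 1] isT).
Definition p654213 : pattern :=
  Tagged (fun m => {perm 'I_m}) (@word_perm 5 [:: 6; 5; 4; 2; 1; 3] isT).

Fixpoint fib (n : nat) : nat :=
  if n is n1.+1 then if n1 is n2.+1 then fib n1 + fib n2 else 1 else 0.

Local Open Scope ring_scope.

(* Formal power series over a field, as their sequences of coefficients. *)
Section PowerSeries.
Variable K : fieldType.

Definition fps : Type := nat -> K.

Definition fps_of_poly (p : {poly K}) : fps := fun n => p`_n.

Definition fps_mul (a b : fps) : fps :=
  fun n => \sum_(i < n.+1) a i * b (n - i)%N.

(* The first n coefficients of the reciprocal of q, by the usual recurrence. *)
Fixpoint fps_inv_coefs (q : fps) (n : nat) : seq K :=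
  if n is k.+1 then
    let s := fps_inv_coefs q k in
    rcons s ((q 0%N)^-1 * ((k == 0%N)%:R - \sum_(i < k) s`_i * q (k - i)%N))
  else [::].

Definition fps_inv (q : fps) : fps := fun n => (fps_inv_coefs q n.+1)`_n.

Definition fps_div (a b : fps) : fps := fps_mul a (fps_inv b).

Lemma size_fps_inv_coefs (q : fps) (n : nat) : size (fps_inv_coefs q n) = n.
Proof. by elim: n => //= n IHn; rewrite size_rcons IHn. Qed.

Lemma nth_fps_inv_coefs (q : fps) (n i : nat) :
  (i < n)%N -> (fps_inv_coefs q n)`_i = fps_inv q i.
Proof.
elim: n => // n IHn; rewrite ltnS leq_eqVlt => /predU1P[-> // | lt_in] /=.
by rewrite nth_rcons size_fps_inv_coefs lt_in IHn.
Qed.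

Lemma fps_mulVq (q : fps) :
  q 0%N != 0 -> fps_mul (fps_inv q) q =1 fps_of_poly 1.
Proof.
move=> q0 n; rewrite /fps_mul big_ord_recr /= subnn /fps_of_poly coef1.
have -> : fps_inv q n = (q 0%N)^-1 *
    ((n == 0%N)%:R - \sum_(i < n) fps_inv q i * q (n - i)%N).
  rewrite {1}/fps_inv /= nth_rcons size_fps_inv_coefs ltnn eqxx.
  by congr (_ * (_ - _)); apply: eq_bigr => i _; rewrite nth_fps_inv_coefs.
by rewrite mulrAC mulVf // mul1r addrC subrK.
Qed.
End PowerSeries.

(* Main.v *)
Require Import Defs.
From mathcomp Require Import all_boot all_order all_fingroup all_algebra.
From mathcomp Require Import zify ring lra.

Set Implicit Arguments.
Unset Strict Implicit.
Unset Printing Implicit Defensive.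

(* Let [w] avoid 132 and 2341, with maximum [n].  Either [w] ends with [n], or the
   letters before [n] are decreasing and exceed all the letters after it.  In the
   second case, with [l] letters before [n], these letters (or [n] itself when
   [l = 0]) extend to the left any pattern found after [n]: hence [w] avoids the
   skew sum of a decreasing word of length [k > 0] and 213 iff the letters after
   [n] avoid the one of length [k - max(1, l)].  This gives linear recurrences for
   the four counting sequences [k = 0, .., 3], the last one being that of 654213,
   which are solved successively in terms of Fibonacci numbers and binomials. *)

Local Open Scope nat_scope.

(** * Occurrences of patterns in words of natural numbers *)

(** Arbitrary words replace permutations, so that subwords and restrictions to small letters need no
    renumbering. *)
Definition order_iso (u s : seq nat) : bool :=
  (size u == size s) &&
  all (fun i => all (fun j => (nth 0 u i < nth 0 u j) == (nth 0 s i < nth 0 s j))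
                    (iota 0 (size s))) (iota 0 (size s)).

Lemma order_isoP (u s : seq nat) :
  reflect (size u = size s /\
           {in gtn (size s) &, forall i j,
              (nth 0 u i < nth 0 u j) = (nth 0 s i < nth 0 s j)})
          (order_iso u s).
Proof.
apply: (iffP andP) => -[size_us us]; split; try exact/eqP.
  move=> i j lt_i lt_j.
  move/allP: us => /(_ i); rewrite mem_iota => /(_ lt_i) /allP /(_ j);
  by rewrite mem_iota => /(_ lt_j) /eqP.
apply/allP=> i; rewrite mem_iota add0n => lt_i.
by apply/allP=> j; rewrite mem_iota add0n => lt_j; rewrite us.
Qed.

(** Quantifying over masks of fixed length keeps the predicate finite, hence Boolean. *)
Definition occurs (s w : seq nat) : bool :=
  [exists m : (size w).-tuple bool, order_iso (mask m w) s].

Lemma occursP (s w : seq nat) :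
  reflect (exists2 u, subseq u w & order_iso u s) (occurs s w).
Proof.
apply: (iffP existsP) => [[m iso_m] | [u /subseqP[m size_m ->] iso_u]].
  by exists (mask m w); rewrite ?mask_subseq.
by exists (tcast size_m (in_tuple m)); rewrite val_tcast.
Qed.

Lemma occurs_subseq (s v w : seq nat) :
  subseq v w -> occurs s v -> occurs s w.
Proof.
move=> sub_vw /occursP[u sub_uv iso_u]; apply/occursP; exists u => //.
exact: subseq_trans sub_vw.
Qed.

Lemma order_iso_behead (x y : nat) (s u : seq nat) :
  order_iso (y :: u) (x :: s) -> order_iso u s.
Proof.
case/order_isoP=> [[size_us] us]; apply/order_isoP; split=> // i j lt_i lt_j.
exact: (us i.+1 j.+1).
Qed.

(** Since [x] exceeds all of [s], the comparisons that involve position 0 amount to all letters of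
    [u] lying below [y]. *)
Lemma order_iso_cons_max (x y : nat) (s u : seq nat) :
  all (gtn x) s ->
  order_iso (y :: u) (x :: s) = all (gtn y) u && order_iso u s.
Proof.
move=> /(all_nthP 0) s_x; apply/idP/andP => [iso | [/(all_nthP 0) u_y iso]].
  split; last exact: order_iso_behead iso.
  case/order_isoP: iso => -[size_us] us; apply/(all_nthP 0) => i lt_i.
  rewrite size_us in lt_i; have := us i.+1 0 lt_i isT.
  by rewrite /= => ->; apply: s_x.
case/order_isoP: iso => size_us us; apply/order_isoP; split=> [|[|i] [|j]].
- by rewrite /= size_us.
- by rewrite !ltnn.
- by move=> _ lt_j; have := s_x j lt_j; have := u_y j; rewrite size_us => /(_ lt_j) /=; lia.
- by move=> lt_i _; have := s_x i lt_i; have := u_y i; rewrite size_us => /(_ lt_i) /=; lia.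
- exact: us.
Qed.

Lemma occurs_behead (x : nat) (s w : seq nat) :
  occurs (x :: s) w -> occurs s w.
Proof.
case/occursP=> -[|y u] sub_uw; first by case/andP.
move/order_iso_behead => iso_u; apply/occursP; exists u => //.
exact: subseq_trans (subseq_cons _ _) sub_uw.
Qed.

Lemma subseq_consP (T : eqType) (u w : seq T) (y : T) :
  reflect (subseq u w \/ exists2 u', u = y :: u' & subseq u' w)
          (subseq u (y :: w)).
Proof.
apply: (iffP idP) => [|[sub_uw | [u' -> sub_uw]]]; last by rewrite /= eqxx.
- case: u => [|x u] /=; first by left; apply: sub0seq.
  by case: eqP => [-> sub_uw | _]; [right; exists u | left].
- exact: subseq_trans (subseq_cons _ _).
Qed.

(** An occurrence either skips [y] or lets it play the maximum [x]; in the second case the rest is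
    found among the later letters below [y]. *)
Lemma occurs_cons_max (x y : nat) (s w : seq nat) :
  all (gtn x) s ->
  occurs (x :: s) (y :: w) = occurs (x :: s) w || occurs s [seq z <- w | z < y].
Proof.
move=> s_x; apply/idP/orP => [/occursP[u /subseq_consP[sub_uw | [u' -> sub_uw]]] | ].
- by move=> iso_u; left; apply/occursP; exists u.
- rewrite order_iso_cons_max // => /andP[u_y iso_u]; right.
  by apply/occursP; exists u'; rewrite // subseq_filter u_y.
- case; first by apply: occurs_subseq; apply: subseq_cons.
  case/occursP=> u; rewrite subseq_filter => /andP[u_y sub_uw] iso_u.
  apply/occursP; exists (y :: u); first by rewrite /= eqxx.
  by rewrite order_iso_cons_max // u_y.
Qed.

(* If too few letters of [w] exceed [y], then [y] cannot play the first letter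
   of the pattern. *)
Lemma occurs_cons_count (x y : nat) (s w : seq nat) :
  count (ltn y) w < count (ltn x) s ->
  occurs (x :: s) (y :: w) = occurs (x :: s) w.
Proof.
move=> lt_count; apply/idP/idP; last first.
  by apply: occurs_subseq; apply: subseq_cons.
case/occursP=> u /subseq_consP[sub_uw iso_u|]; first by apply/occursP; exists u.
case=> u' -> sub_uw /order_isoP[[size_us] us].
have eq_map : map (ltn x) s = map (ltn y) u'.
  apply: (@eq_from_nth _ false) => [|i]; rewrite ?size_map //= => lt_i.
  rewrite !(nth_map 0) ?size_us //; exact/esym/(us 0 i.+1).
have : count id (map (ltn x) s) = count id (map (ltn y) u') by rewrite eq_map.
rewrite !count_map => eq_c; have := leq_count_subseq (ltn y) sub_uw.
by rewrite leqNgt -(eq_count (a1 := preim (ltn y) id)) // -eq_c lt_count.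
Qed.

(** The last letter of [s] lies below another letter of [s], so a final letter exceeding all of [w]
    cannot play it. *)
Lemma occurs_rcons_max (y : nat) (s w : seq nat) :
  all (gtn y) w -> has (ltn (last 0 s)) s ->
  occurs s (rcons w y) = occurs s w.
Proof.
move=> w_y s_last; apply/idP/idP; last first.
  by apply: occurs_subseq; apply: subseq_rcons.
(* Reversal makes the last letter a first one, so that [subseq_consP] applies. *)
case/occursP=> u; rewrite -subseq_rev rev_rcons => /subseq_consP[|[u' eq_u]].
  by rewrite subseq_rev => sub_uw iso_u; apply/occursP; exists u.
rewrite -(revK u') subseq_rev => sub_uw /order_isoP[size_us us].
have {}eq_u : u = rcons (rev u') y by rewrite -(revK u) eq_u rev_cons.
case/(has_nthP 0): s_last => i lt_i; rewrite /= -nth_last => lt_last.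
have lt_s : (size s).-1 < size s by lia.
have := us _ _ lt_s lt_i; rewrite lt_last -size_us nth_last eq_u last_rcons.
have: nth 0 (rcons (rev u') y) i \in rcons (rev u') y by rewrite mem_nth // -eq_u size_us.
rewrite mem_rcons inE => /predU1P[-> | /(mem_subseq sub_uw)/(allP w_y) /=]; lia.
Qed.

(** An increasing choice of positions is the same as a subword of the one-line word; this moves the
    whole problem from permutations to words. *)
Lemma contains_occurs (n m : nat) (p : {perm 'I_n}) (s : {perm 'I_m}) :
  contains p s = occurs (one_line s) (one_line p).
Proof.
have sorted_enum k : sorted (fun i j : 'I_k => i < j) (enum 'I_k).
  have := iota_ltn_sorted 0 k; rewrite -val_enum_ord sorted_map; exact: sub_sorted.
have ltn_tr k : transitive (fun i j : 'I_k => i < j) by move=> j i l; apply: ltn_trans.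
have size_one_line k (q : {perm 'I_k}) : size (one_line q) = k.
  by rewrite size_map size_enum_ord.
have nth_one_line k (q : {perm 'I_k}) (i : 'I_k) : nth 0 (one_line q) i = (q i).+1.
  by rewrite (nth_map i) ?size_enum_ord // nth_ord_enum.
apply/existsP/occursP => [[f /andP[/'forall_'forall_implyP f_lt /'forall_'forall_eqP f_iso]] | ].
  exists [seq (p (f a)).+1 | a <- enum 'I_m].
    rewrite /one_line (map_comp (fun i => (p i).+1) f) map_subseq //.
    (* The image of [f], listed in order, is a filtered [enum]: both lists are strictly sorted and
       have the same elements. *)
    rewrite (_ : map f _ = [seq i <- enum 'I_n | i \in map f (enum 'I_m)]) ?filter_subseq //.
    apply: (irr_sorted_eq (@ltn_tr n)).
    + by move=> i /=; rewrite ltnn.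
    + by rewrite sorted_map; apply: sub_sorted (sorted_enum m); apply: f_lt.
    + exact: (sorted_filter (@ltn_tr n)).
    + by move=> i; rewrite mem_filter mem_enum andbT.
  apply/order_isoP; rewrite size_one_line; split.
    by rewrite size_map size_enum_ord.
  move=> i j lt_i lt_j.
  rewrite -[i]/(nat_of_ord (Ordinal lt_i)) -[j]/(nat_of_ord (Ordinal lt_j)).
  move: (Ordinal lt_i) (Ordinal lt_j) => {lt_i lt_j}i {}j.
  have nth_u (a : 'I_m) : nth 0 [seq (p (f b)).+1 | b <- enum 'I_m] a = (p (f a)).+1.
    by rewrite (nth_map a) ?size_enum_ord // nth_ord_enum.
  rewrite !nth_one_line !nth_u !ltnS.
  exact: f_iso.
case=> u /subseqP[b size_b ->] /order_isoP[].
rewrite size_one_line {2 3}/one_line -map_mask; set v := mask b _.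
rewrite size_map => size_v iso_v.
have sub_v : subseq v (enum 'I_n) by rewrite mask_subseq.
have sort_v : sorted (fun i j : 'I_n => i < j) v.
  exact: (subseq_sorted (@ltn_tr n) sub_v (sorted_enum n)).
have nth_v (a : 'I_m) :
    nth 0 [seq (p i).+1 | i <- v] a = (p (tnth (tcast size_v (in_tuple v)) a)).+1.
  have x0 : 'I_n := tnth (tcast size_v (in_tuple v)) a.
  by rewrite (tnth_nth x0) val_tcast (nth_map x0) ?size_v.
exists [ffun a => tnth (tcast size_v (in_tuple v)) a]; apply/andP; split.
  apply/'forall_'forall_implyP => a c lt_ac; rewrite !ffunE.
  have x0 : 'I_n := tnth (tcast size_v (in_tuple v)) a.
  rewrite !(tnth_nth x0) val_tcast.
  by apply: (sorted_ltn_nth (@ltn_tr n) x0 sort_v a c); rewrite ?inE ?size_v.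
apply/'forall_'forall_eqP => a c; rewrite !ffunE.
have := iso_v a c (ltn_ord a) (ltn_ord c).
by rewrite !nth_v // !nth_one_line !ltnS.
Qed.

(** * Occurrences of the patterns in a word split at its maximum *)

(* [skew213 k] is the skew sum of a decreasing word of length [k] and 213. *)
Fixpoint skew213 (k : nat) : seq nat :=
  if k is k'.+1 then k + 3 :: skew213 k' else [:: 2; 1; 3].

Lemma skew213_lt (k : nat) : all (gtn (k + 4)) (skew213 k).
Proof.
elim: k => //= k IHk; apply/andP; split; first by rewrite /=; lia.
by apply: sub_all IHk => x /=; lia.
Qed.

Lemma last_skew213 (k x : nat) : last x (skew213 k) = 3.
Proof. by elim: k x => //= k IHk x. Qed.

Lemma occurs_skew213S_cons (k y : nat) (w : seq nat) :
  occurs (skew213 k.+1) (y :: w) =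
  occurs (skew213 k.+1) w || occurs (skew213 k) [seq z <- w | z < y].
Proof. by rewrite /= occurs_cons_max // addSnnS skew213_lt. Qed.

Lemma occurs_skew213_leq (k k' : nat) (w : seq nat) :
  k' <= k -> occurs (skew213 k) w -> occurs (skew213 k') w.
Proof.
move=> /subnK <-; elim: (k - k') => //= d IHd; rewrite addSn /= => occ.
exact/IHd/(occurs_behead occ).
Qed.

Lemma occurs213P (w : seq nat) :
  reflect (exists a b c, subseq [:: a; b; c] w /\ b < a < c)
          (occurs [:: 2; 1; 3] w).
Proof.
apply: (iffP (occursP _ _)) => [[[|a [|b [|c []]]] //] sub_w | [a [b [c [sub_w lt_abc]]]]].
  by case/order_isoP=> _ iso; exists a, b, c; rewrite (iso 1 0) // (iso 0 2).
exists [:: a; b; c] => //.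
by apply/order_isoP; split=> [|[|[|[|i]]] [|[|[|j]]] _ _] //=; lia.
Qed.

Lemma occurs132P (w : seq nat) :
  reflect (exists a b c, subseq [:: a; b; c] w /\ a < c < b)
          (occurs [:: 1; 3; 2] w).
Proof.
apply: (iffP (occursP _ _)) => [[[|a [|b [|c []]]] //] sub_w | [a [b [c [sub_w lt_abc]]]]].
  by case/order_isoP=> _ iso; exists a, b, c; rewrite (iso 0 2) // (iso 2 1).
exists [:: a; b; c] => //.
by apply/order_isoP; split=> [|[|[|[|i]]] [|[|[|j]]] _ _] //=; lia.
Qed.

Lemma occurs2341P (w : seq nat) :
  reflect (exists a b c d, subseq [:: a; b; c; d] w /\ [&& d < a, a < b & b < c])
          (occurs [:: 2; 3; 4; 1] w).
Proof.
apply: (iffP (occursP _ _)) 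
  => [[[|a [|b [|c [|d []]]]] //] sub_w | [a [b [c [d [sub_w lt_abcd]]]]]].
  by case/order_isoP=> _ iso; exists a, b, c, d; rewrite (iso 3 0) // (iso 0 1) // (iso 1 2).
exists [:: a; b; c; d] => //.
by apply/order_isoP; split=> [|[|[|[|[|i]]]] [|[|[|[|j]]]] _ _] //=; lia.
Qed.

(** Letters of [d] greedily play the leading letters of the pattern. The subtraction truncates: once
    only 213 is left, a letter of [d] cannot play its 2, as nothing larger follows. *)
Lemma occurs_skew213_cat (k : nat) (d w : seq nat) :
  pairwise gtn d -> allrel gtn d w ->
  occurs (skew213 k) (d ++ w) = occurs (skew213 (k - size d)) w.
Proof.
elim: d k => [|x d IHd] [|k] //; rewrite ?subn0 // pairwise_cons allrel_consl cat_cons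
  => /andP[d_x dec_d] /andP[w_x dw].
- have dw_x : all (gtn x) (d ++ w) by rewrite all_cat d_x.
  rewrite /= occurs_cons_count ?(IHd 0) //=.
  by rewrite (eq_in_count (a2 := pred0)) ?count_pred0 // => y /(allP dw_x) /=; lia.
- have dw_x : all (gtn x) (d ++ w) by rewrite all_cat d_x.
  rewrite occurs_skew213S_cons (_ : [seq z <- _ | _] = d ++ w); last exact/all_filterP.
  (* The case that skips [x] gives an occurrence of a pattern at least as long, hence of the
     required one. *)
  rewrite !IHd // [size (x :: d)]/= subSS; apply/orP/idP => [[]|->]; [|by []|by right].
  by apply: occurs_skew213_leq; lia.
Qed.

(** No occurrence uses both [n] and a letter of [d]: [n] would have to play the 3, though the
    pattern has a larger letter before it. So what precedes [w] absorbs either one letter, by [n],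
    or up to [size d] letters. *)
Lemma occurs_skew213S_peak (k n : nat) (d w : seq nat) :
  pairwise gtn d -> allrel gtn d w -> all (gtn n) (d ++ w) ->
  occurs (skew213 k.+1) (d ++ n :: w) = occurs (skew213 (k.+1 - maxn 1 (size d))) w.
Proof.
elim: d => [_ _ w_n|x d IHd]; rewrite ?cat0s.
  rewrite occurs_skew213S_cons (_ : [seq z <- _ | _] = w); last exact/all_filterP.
  rewrite subn1 /=; apply/orP/idP => [[]|->]; [|by []|by right].
  exact: occurs_behead.
rewrite pairwise_cons allrel_consl => /andP[d_x dec_d] /andP[w_x dw] /= /andP[x_n dw_n].
(* Restricting to the letters below [x] deletes [n] and leaves a decreasing prefix followed by
   [w]. *)
rewrite occurs_skew213S_cons IHd // filter_cat /= [n < x]ltnNge (ltnW x_n) /=.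
rewrite (all_filterP (a := fun z => z < x) d_x) (all_filterP (a := fun z => z < x) w_x).
rewrite occurs_skew213_cat // (_ : k.+1 - maxn 1 (size d).+1 = k - size d); last by lia.
apply/orP/idP => [[]|->]; [|by []|by right].
by apply: occurs_skew213_leq; lia.
Qed.

(** The first letter of the pattern is exceeded by at least two later ones, whereas after a letter
    of [d] only [n] is larger, and after [n] nothing is. Both 132 and 2341 have this form. *)
Lemma occurs_peak (x n : nat) (s d w : seq nat) :
  1 < count (ltn x) s ->
  pairwise gtn d -> allrel gtn d w -> all (gtn n) (d ++ w) ->
  occurs (x :: s) (d ++ n :: w) = occurs (x :: s) w.
Proof.
move=> s_x; have count0 y u : all (gtn y) u -> count (ltn y) u = 0.
  move=> u_y; rewrite (eq_in_count (a2 := pred0)) ?count_pred0 // => z.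
  by move/(allP u_y) => /=; lia.
elim: d => [|y d IHd]; first by move=> _ _ w_n; rewrite occurs_cons_count // count0 //; lia.
rewrite pairwise_cons allrel_consl => /andP[d_y dec_d] /andP[w_y dw] /= /andP[_ dw_n].
rewrite occurs_cons_count ?IHd // count_cat /= (count0 _ d) // (count0 _ w) //.
by apply: leq_trans s_x; lia.
Qed.

(** Here [n] can play the 3 after any two letters of [d]; a single letter before [n] leaves no room
    for the 21. *)
Lemma occurs213_peak (n : nat) (d w : seq nat) :
  pairwise gtn d -> allrel gtn d w -> all (gtn n) (d ++ w) ->
  occurs [:: 2; 1; 3] (d ++ n :: w) = (1 < size d) || occurs [:: 2; 1; 3] w.
Proof.
case: d => [|x [|y d]].
- move=> _ _ w_n; rewrite occurs_cons_count // (eq_in_count (a2 := pred0)) ?count_pred0 //.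
  by move=> z /(allP w_n) /=; lia.
- rewrite allrel1l => _ w_x /= /andP[x_n w_n]; apply/idP/idP; last first.
    by apply: (occurs_subseq (subseq_trans (subseq_cons _ n) (subseq_cons _ x))).
  case/occurs213P=> a [b [c [sub lt_abc]]]; apply/occurs213P; exists a, b, c; split=> //.
  move: sub => /=; case: eqP => [ax | _].
    case: eqP => [bn | _]; first by lia.
    move/mem_subseq/(_ c); rewrite !inE eqxx orbT => /(_ isT) /(allP w_x) /=; lia.
  case: eqP => [an | //]; move/mem_subseq/(_ c); rewrite !inE eqxx orbT.
  by move=> /(_ isT) /(allP w_n) /=; lia.
- rewrite /= => /andP[/andP[y_x _] _] _ /andP[x_n _]; apply/occurs213P.
  exists x, y, n; split; last by rewrite y_x.
  rewrite /= !eqxx; by rewrite sub1seq mem_cat mem_head orbT.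
Qed.

(** The final maximum plays the 3, so 213 reduces to an inversion in [w]. *)
Lemma occurs213_rcons (n : nat) (w : seq nat) :
  all (gtn n) w -> occurs [:: 2; 1; 3] (rcons w n) = ~~ pairwise leq w.
Proof.
move=> w_n; apply/idP/idP.
  case/occurs213P=> a [b [c [sub lt_abc]]]; apply/negP => inc_w.
  have : pairwise leq (rcons w n).
    rewrite -cats1 pairwise_cat inc_w /= andbT allrel1r.
    by apply: sub_all w_n => z /=; lia.
  by move/(subseq_pairwise sub) => /=; lia.
elim: w w_n => //= x w IHw /andP[x_n w_n]; rewrite negb_and => /orP[|/(IHw w_n) occ]; last first.
  exact: occurs_subseq (subseq_cons _ _) occ.
rewrite -has_predC => /hasP[y y_w /= lt_yx]; apply/occurs213P; exists x, y, n.
split; last by lia.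
rewrite /= eqxx -cats1; apply: (@cat_subseq _ [:: y] [:: n]); first by rewrite sub1seq.
exact: subseq_refl.
Qed.

(** * Decomposition at the maximum of the words avoiding 132 and 2341 *)

(** The third pattern is left out, so that one decomposition serves all the counting sequences. *)
Definition words (n : nat) : seq (seq nat) :=
  [seq w <- permutations (iota 1 n)
  | ~~ occurs [:: 1; 3; 2] w && ~~ occurs [:: 2; 3; 4; 1] w].

Lemma mem_words (n : nat) (w : seq nat) :
  (w \in words n) =
  [&& perm_eq w (iota 1 n), ~~ occurs [:: 1; 3; 2] w & ~~ occurs [:: 2; 3; 4; 1] w].
Proof. by rewrite mem_filter mem_permutations andbC. Qed.

Lemma words_uniq (n : nat) : uniq (words n).
Proof. by rewrite filter_uniq ?permutations_uniq. Qed.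

Lemma words_lt (n x : nat) (w : seq nat) : w \in words n -> n < x -> all (gtn x) w.
Proof.
rewrite mem_words => /andP[/perm_mem w_n _] lt_nx; apply/allP => y.
by rewrite w_n mem_iota /=; lia.
Qed.

Definition peak (m l : nat) (w : seq nat) : seq nat :=
  rev (iota m.+1 l) ++ (m + l).+1 :: w.

Lemma pairwise_rev_iota (m l : nat) : pairwise gtn (rev (iota m l)).
Proof.
rewrite -sorted_pairwise; last by move=> y x z /= xy yz; apply: ltn_trans yz xy.
by rewrite rev_sorted iota_ltn_sorted.
Qed.

Lemma peak_conditions (m l : nat) (w : seq nat) : w \in words m ->
  [/\ pairwise gtn (rev (iota m.+1 l)), allrel gtn (rev (iota m.+1 l)) w
    & all (gtn (m + l).+1) (rev (iota m.+1 l) ++ w)].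
Proof.
move=> w_m; split; first exact: pairwise_rev_iota.
  apply/allrelP => x y; rewrite mem_rev mem_iota => /andP[lt_mx _].
  by move/(allP (words_lt w_m lt_mx)).
rewrite all_cat (words_lt w_m) ?andbT ?ltnS ?leq_addr //.
by apply/allP => x; rewrite mem_rev mem_iota /=; lia.
Qed.

Lemma perm_iotaS (n : nat) : perm_eq (iota 1 n.+1) (n.+1 :: iota 1 n).
Proof. by rewrite -(addn1 n) iotaD perm_catC add1n addn1. Qed.

Lemma rcons_words (n : nat) (w : seq nat) :
  w \in words n -> rcons w n.+1 \in words n.+1.
Proof.
move=> w_n; have lt_w := words_lt w_n (ltnSn n); move: w_n.
rewrite !mem_words !(occurs_rcons_max lt_w) // => /andP[w_n ->]; rewrite andbT.
by rewrite perm_rcons perm_sym (perm_trans (perm_iotaS n)) // perm_cons perm_sym.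
Qed.

Lemma peak_words (m l : nat) (w : seq nat) :
  w \in words m -> peak m l w \in words (m + l).+1.
Proof.
move=> w_m; have [dec_d dw dw_n] := peak_conditions l w_m; move: w_m.
rewrite !mem_words !(occurs_peak _ dec_d dw dw_n) // => /andP[w_m ->]; rewrite andbT.
rewrite /peak perm_sym (perm_trans (perm_iotaS _)) // perm_sym -(cat1s _ w) perm_catCA perm_cons.
by rewrite iotaD perm_catC perm_cat ?perm_rev.
Qed.

Lemma pairwise_subseq2 (T : eqType) (r : rel T) (w : seq T) :
  (forall x y, subseq [:: x; y] w -> r x y) -> pairwise r w.
Proof.
elim: w => //= x w IHw r_w; apply/andP; split.
  by apply/allP => y y_w; apply: r_w; rewrite eqxx sub1seq.
by apply: IHw => a b sub; apply: r_w; apply: subseq_trans sub (subseq_cons _ _).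
Qed.

(** Avoiding 132 with the maximum as 3 puts [u] above [v]; avoiding 2341 with the maximum as 4 and a
    letter of the nonempty [v] as 1 makes [u] decreasing. The letters of [u] are then forced. *)
Lemma words_peak (n : nat) (u v : seq nat) :
  u ++ n.+1 :: v \in words n.+1 -> v != [::] ->
  v \in words (size v) /\ u ++ n.+1 :: v = peak (size v) (size u) v.
Proof.
rewrite mem_words => /and3P[perm_uv no132 no2341] v_n0.
have {}perm_uv : perm_eq (u ++ v) (iota 1 n).
  rewrite -(perm_cons n.+1) -cat1s perm_catCA /= (perm_trans perm_uv) //.
  exact: perm_iotaS.
have size_uv : size u + size v = n by rewrite -size_cat (perm_size perm_uv) size_iota.
have lt_n x : x \in u ++ v -> x <= n by rewrite (perm_mem perm_uv) mem_iota; lia.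
have uniq_uv : uniq (u ++ v) by rewrite (perm_uniq perm_uv) iota_uniq.
have lt_vu x y : x \in u -> y \in v -> y < x.
  move=> x_u y_v; rewrite ltn_neqAle; apply/andP; split.
    apply: contraTneq uniq_uv => eq_yx; rewrite cat_uniq; apply/negP => /and3P[_ /hasPn/(_ y y_v)].
    by rewrite eq_yx x_u.
  rewrite leqNgt; apply: contra no132 => lt_xy; apply/occurs132P; exists x, n.+1, y.
  split; last by rewrite lt_xy ltnS lt_n // mem_cat y_v orbT.
  by apply: (@cat_subseq _ [:: x] [:: n.+1; y]); rewrite ?sub1seq //= eqxx sub1seq.
have [y0 y0_v] : exists y0, y0 \in v.
  by case: (v) v_n0 => // y v' _; exists y; rewrite mem_head.
have dec_u : pairwise gtn u.
  apply: pairwise_subseq2 => a b sub_ab.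
  have a_u : a \in u by apply: (mem_subseq sub_ab); rewrite mem_head.
  have b_u : b \in u by apply: (mem_subseq sub_ab); rewrite !inE eqxx orbT.
  have ab : a != b.
    have : uniq [:: a; b].
      by apply: subseq_uniq sub_ab _; move: uniq_uv; rewrite cat_uniq => /andP[].
    by rewrite /= inE andbT.
  rewrite /= ltn_neqAle eq_sym ab leqNgt; apply: contra no2341 => lt_ab.
  apply/occurs2341P; exists a, b, n.+1, y0; split; last first.
    by rewrite lt_vu // lt_ab ltnS lt_n // mem_cat b_u.
  by apply: (@cat_subseq _ [:: a; b] [:: n.+1; y0]); rewrite //= eqxx sub1seq.
(* [sort v ++ rev u] is the increasing rearrangement of [iota 1 n]. *)
have eq_iota : sort leq v ++ rev u = iota 1 (size v) ++ iota (1 + size v) (size u).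
  rewrite -iotaD addnC size_uv; apply: (sorted_eq leq_trans anti_leq).
  - rewrite sorted_pairwise; last exact: leq_trans.
    rewrite pairwise_cat -!sorted_pairwise; try exact: leq_trans.
    rewrite sort_sorted ?andbT; last exact: leq_total.
    rewrite rev_sorted; apply/andP; split.
      apply/allrelP => y x; rewrite mem_sort mem_rev => y_v x_u.
      exact/ltnW/lt_vu.
    apply: sub_sorted (_ : sorted gtn u) => [x y /ltnW //|].
    exact: pairwise_sorted.
  - exact: iota_sorted.
  - apply: perm_trans perm_uv; rewrite perm_catC perm_cat ?perm_rev //.
    by rewrite perm_sort.
move/eqP: eq_iota; rewrite eqseq_cat ?size_sort ?size_iota // => /andP[/eqP sort_v /eqP rev_u].
split; last first.
  rewrite /peak -(add1n (size v)) -rev_u revK; congr (_ ++ _ :: _).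
  by rewrite addnC size_uv.
rewrite mem_words -sort_v perm_sym perm_sort perm_refl /=.
have sub_v : subseq v (u ++ n.+1 :: v).
  exact: subseq_trans (subseq_cons _ _) (suffix_subseq _ _).
by apply/andP; split; [apply: contra no132 | apply: contra no2341]; apply: occurs_subseq.
Qed.

Lemma words_rcons (n : nat) (u : seq nat) :
  rcons u n.+1 \in words n.+1 -> u \in words n.
Proof.
rewrite !mem_words => /and3P[perm_u no132 no2341]; apply/and3P; split.
- rewrite -(perm_cons n.+1) -perm_rcons (perm_trans perm_u) //.
  exact: perm_iotaS.
- by apply: contra no132; apply/occurs_subseq/subseq_rcons.
- by apply: contra no2341; apply/occurs_subseq/subseq_rcons.
Qed.

(** The first family ends with the maximum. In the second, [l < n] means that a nonempty word
    follows the maximum. The last letter separates the families, and the position of the maximum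
    determines [l]. *)
Lemma perm_words (n : nat) :
  perm_eq (words n.+1)
    ([seq rcons w n.+1 | w <- words n] ++
     [seq peak (n - l) l w | l <- iota 0 n, w <- words (n - l)]).
Proof.
have peakP l w : l \in iota 0 n -> w \in words (n - l) ->
    [/\ l < n, peak (n - l) l w = rev (iota (n - l).+1 l) ++ n.+1 :: w,
        n.+1 \notin rev (iota (n - l).+1 l) & last 0 (peak (n - l) l w) < n.+1].
  rewrite mem_iota add0n => /andP[_ lt_ln] w_nl.
  rewrite /peak (subnK (ltnW lt_ln)); split=> //; first by rewrite mem_rev mem_iota; lia.
  have := w_nl; rewrite mem_words => /andP[perm_w _].
  have := perm_size perm_w; rewrite size_iota last_cat /=.
  case: w w_nl perm_w => /= [|x w] w_nl _ size_w; first by lia.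
  have lt_x : n - l < n.+1 by lia.
  by have /allP := words_lt w_nl lt_x; apply; rewrite mem_last.
apply: uniq_perm; first exact: words_uniq.
  rewrite cat_uniq map_inj_uniq ?words_uniq /=; last exact: rcons_injl.
  apply/andP; split.
    apply/hasPn => _ /allpairsPdep[l [w [l_n w_nl ->]]].
    have [_ _ _ lt_last] := peakP l w l_n w_nl; apply/negP => /mapP[w' _ eq_w].
    by move: lt_last; rewrite eq_w last_rcons ltnn.
  apply: allpairs_uniq_dep; [exact: iota_uniq | by move=> l _; apply: words_uniq |].
  move=> _ _ /allpairsPdep[l1 [w1 [l1_n w1_n ->]]] /allpairsPdep[l2 [w2 [l2_n w2_n ->]]] /=.
  have [_ -> n_d1 _] := peakP l1 w1 l1_n w1_n; have [_ -> n_d2 _] := peakP l2 w2 l2_n w2_n.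
  move=> eq_w; have : l1 = l2.
    move/(congr1 (index n.+1)): eq_w; rewrite !index_cat (negPf n_d1) (negPf n_d2) /= eqxx.
    by rewrite !size_rev !size_iota !addn0.
  move=> eq_l; rewrite -eq_l in eq_w *; move/eqP: eq_w.
  by rewrite eqseq_cat // => /andP[_ /eqP[->]].
move=> w; rewrite mem_cat; apply/idP/orP => [w_n | []]; last first.
- case/allpairsPdep=> l [w' [l_n w'_n ->]]; have [lt_ln _ _ _] := peakP l w' l_n w'_n.
  by have := peak_words l w'_n; rewrite (subnK (ltnW lt_ln)).
- by case/mapP=> w' w'_n ->; apply: rcons_words.
have n_w : n.+1 \in w.
  by have := w_n; rewrite mem_words => /andP[/perm_mem-> _]; rewrite mem_iota; lia.
case/splitPr: n_w w_n => u v w_n; have [v0 | v_n0] := eqVneq v [::].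
  left; rewrite v0 cats1 in w_n *; apply: map_f; exact: words_rcons.
right; have size_uv : size u + size v = n.
  have := w_n; rewrite mem_words => /andP[/perm_size].
  by rewrite size_iota size_cat /= addnS => -[].
have [v_w ->] := words_peak w_n v_n0; apply/allpairsPdep; exists (size u), v.
rewrite mem_iota (_ : n - size u = size v); last by lia.
split=> //; rewrite add0n leq0n /= -size_uv -addn1 leq_add2l.
by rewrite lt0n size_eq0.
Qed.

(** * Recurrences for the counting sequences *)

Definition skew_avoiders (k n : nat) : nat :=
  count (fun w => ~~ occurs (skew213 k) w) (words n).

Lemma card_avoiders (n : nat) :
  #|avoiders n [:: p132; p654213; p2341]| = skew_avoiders 3 n.
Proof.
have one_line_inj : injective (@one_line n).
  move=> p q /eq_in_map eq_pq; apply/permP => i; apply/val_inj.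
  by case: (eq_pq i (mem_enum _ i)).
rewrite /skew_avoiders -size_filter cardE -(size_map (@one_line n)).
apply/perm_size/uniq_perm.
- by rewrite map_inj_uniq ?enum_uniq.
- by rewrite filter_uniq ?words_uniq.
move=> w; rewrite mem_filter mem_words.
have avoidE (p : {perm 'I_n}) : (p \in avoiders n [:: p132; p654213; p2341]) =
    [&& ~~ occurs [:: 1; 3; 2] (one_line p), ~~ occurs (skew213 3) (one_line p)
      & ~~ occurs [:: 2; 3; 4; 1] (one_line p)].
  rewrite inE /= andbT /avoids !contains_occurs.
  by rewrite /p132 /p654213 /p2341 /= !one_line_word_perm.
apply/mapP/and4P => [[p + ->] | [no654213 perm_w no132 no2341]].
  rewrite mem_enum avoidE => /and3P[-> -> ->]; split=> //.
  apply: uniq_perm; rewrite ?iota_uniq //.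
    rewrite map_inj_uniq ?enum_uniq // => i j [/val_inj eq_ij].
    exact: perm_inj eq_ij.
  move=> x; rewrite mem_iota; apply/mapP/andP => [[i _ ->] | [x_gt0 x_le]].
    by split; rewrite // add1n ltnS; apply: ltn_ord.
  have lt_x : x.-1 < n by rewrite -ltnS prednK.
  exists (p^-1%g (Ordinal lt_x)); first by rewrite mem_enum.
  by rewrite permKV /= prednK.
have [p eq_w] : exists p : {perm 'I_n}, one_line p = w.
  (* [word_perm] only builds permutations of positive degree; for [n = 0] the identity represents
     the empty word. *)
  case: n perm_w {one_line_inj avoidE} => [|m] perm_w; last first.
    by exists (word_perm perm_w); rewrite one_line_word_perm.
  exists 1%g; rewrite (size0nil (perm_size perm_w)); apply: size0nil.
  by rewrite size_map size_enum_ord.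
by exists p; rewrite // mem_enum avoidE eq_w; apply/and3P.
Qed.

Lemma count_words (n : nat) (a : pred (seq nat)) :
  count a (words n.+1) =
  count (fun w => a (rcons w n.+1)) (words n) +
  \sum_(0 <= l < n) count (fun w => a (peak (n - l) l w)) (words (n - l)).
Proof.
rewrite (seq.permP (perm_words n)) count_cat count_map; congr (_ + _).
rewrite count_flatten sumnE !big_map /index_iota subn0.
by apply: eq_bigr => l _; rewrite count_map.
Qed.

(** A final maximum creates no occurrence, since the pattern ends with 3 but begins with a larger
    letter; a peak lowers the index by [maxn 1 l]. *)
Lemma skew_avoidersS (k n : nat) :
  skew_avoiders k.+1 n.+1 =
  skew_avoiders k.+1 n +
  \sum_(0 <= l < n) skew_avoiders (k.+1 - maxn 1 l) (n - l).
Proof.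
rewrite /skew_avoiders count_words; congr (_ + _).
  apply: eq_in_count => w w_n; rewrite occurs_rcons_max //.
    exact: words_lt w_n (ltnSn n).
  by rewrite last_skew213 /= addSn addnC.
apply: eq_bigr => l _; apply: eq_in_count => w w_n.
have [dec_d dw dw_n] := peak_conditions l w_n.
by rewrite occurs_skew213S_peak // size_rev size_iota.
Qed.

(** Before a final maximum only the increasing word is allowed, whence the 1; a peak with at least
    two letters before its maximum always contains 213. *)
Lemma skew_avoiders0S (n : nat) :
  skew_avoiders 0 n.+1 =
  1 + \sum_(0 <= l < n) (if l < 2 then skew_avoiders 0 (n - l) else 0).
Proof.
rewrite /skew_avoiders count_words; congr (_ + _).
  rewrite (eq_in_count (a2 := pred1 (iota 1 n))).
    rewrite count_uniq_mem ?words_uniq // mem_words perm_refl /=.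
    have inc : pairwise ltn (iota 1 n).
      by rewrite -sorted_pairwise ?iota_ltn_sorted //; apply: ltn_trans.
    case: occurs132P => [[a [b [c [sub]]]]|_].
      by have /= := subseq_pairwise sub inc; lia.
    case: occurs2341P => [[a [b [c [d [sub]]]]]|_] //.
    by have /= := subseq_pairwise sub inc; lia.
  move=> w w_n; rewrite occurs213_rcons ?negbK; last exact: words_lt w_n (ltnSn n).
  rewrite -sorted_pairwise; last exact: leq_trans.
  apply/idP/eqP => [inc_w | ->]; last exact: iota_sorted.
  apply: (sorted_eq leq_trans anti_leq) => //; first exact: iota_sorted.
  by move: w_n; rewrite mem_words => /andP[].
apply: eq_bigr => l _; have [lt_l2 | ge_l2] := ltnP l 2.
  apply: eq_in_count => w w_n; have [dec_d dw dw_n] := peak_conditions l w_n.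
  by rewrite occurs213_peak // size_rev size_iota ltnNge -ltnS lt_l2.
rewrite (eq_in_count (a2 := pred0)) ?count_pred0 // => w w_n.
have [dec_d dw dw_n] := peak_conditions l w_n.
by rewrite occurs213_peak // size_rev size_iota ge_l2.
Qed.

(** * Solution of the recurrences *)

Local Arguments fib : simpl never.

Lemma skew_avoiders_n0 (k : nat) : skew_avoiders k 0 = 1.
Proof.
have occurs_nil x s : occurs (x :: s) [::] = false.
  by apply/negbTE/occursP => -[[]].
by rewrite /skew_avoiders /words /= !occurs_nil /= addn0; case: k => [|k] /=; rewrite occurs_nil.
Qed.

Lemma fibSS (n : nat) : fib n.+2 = fib n.+1 + fib n.
Proof. by []. Qed.

(** Adding 1 turns a(n+3) = a(n+2) + a(n+1) + 1 into the Fibonacci recurrence; the induction carries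
    two consecutive values. *)
Lemma skew_avoiders0E (n : nat) : skew_avoiders 0 n.+1 + 1 = fib n.+3.
Proof.
suff [] : skew_avoiders 0 n.+1 + 1 = fib n.+3 /\ skew_avoiders 0 n.+2 + 1 = fib n.+4 by [].
have N1 : skew_avoiders 0 1 = 1 by rewrite skew_avoiders0S big_nil.
elim: n => [|n [IHn IHn1]].
  by rewrite N1 skew_avoiders0S big_nat1 N1.
split=> //; rewrite skew_avoiders0S big_nat_recl //= big_nat_recl //= big1 ?addn0 //.
by rewrite subn0 subn1 /= (fibSS n.+3); lia.
Qed.

Lemma sum_skew_avoiders0 (n : nat) :
  \sum_(0 <= l < n) skew_avoiders 0 (n - l) + n + 3 = fib n.+4.
Proof.
elim: n => [|n IHn]; first by rewrite big_nil.
rewrite big_nat_recl //= subn0; have := skew_avoiders0E n; rewrite !fibSS in IHn *.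
by under eq_bigr do rewrite subSS; lia.
Qed.

(** Since [1 - maxn 1 l] is 0 for every [l], all peak terms belong to the sequence [k = 0]. *)
Lemma skew_avoiders1S (n : nat) :
  skew_avoiders 1 n.+1 + n + 3 = skew_avoiders 1 n + fib n.+4.
Proof.
rewrite -sum_skew_avoiders0 skew_avoidersS (eq_bigr (fun l => skew_avoiders 0 (n - l))).
  by lia.
by move=> l _; congr (skew_avoiders _ _); lia.
Qed.

(** Negative terms are moved to the left, here and below, to stay in the natural numbers. Pascal's
    rule and the Fibonacci recurrence make the induction step linear. *)
Lemma skew_avoiders1E (n : nat) :
  skew_avoiders 1 n + 'C(n, 2) + 3 * n + 4 = 3 * fib n + 5 * fib n.+1.
Proof.
elim: n => [|n IHn]; first by rewrite skew_avoiders_n0.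
have := skew_avoiders1S n; rewrite !binS bin1 !fibSS in IHn *; lia.
Qed.

Lemma skew_avoiders2S (n : nat) :
  skew_avoiders 2 n.+3 + n + 3 =
  skew_avoiders 2 n.+2 + skew_avoiders 1 n.+2 + skew_avoiders 1 n.+1 + fib n.+4.
Proof.
rewrite -sum_skew_avoiders0 skew_avoidersS 2?big_nat_recl // subn0 subn1.
rewrite (eq_bigr (fun l => skew_avoiders 0 (n - l))); first last.
  by move=> l _; congr (skew_avoiders _ _); lia.
by rewrite -[2 - maxn 1 0]/1; rewrite /=; lia.
Qed.

(** The peak terms have index 2 for [l] equal to 0 or 1, index 1 for [l = 2], and index 0 from
    [l = 3] on. *)
Lemma skew_avoiders3S (n : nat) :
  skew_avoiders 3 n.+4 + n + 3 =
  skew_avoiders 3 n.+3 + skew_avoiders 2 n.+3 + skew_avoiders 2 n.+2 +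
  skew_avoiders 1 n.+1 + fib n.+4.
Proof.
rewrite -sum_skew_avoiders0 skew_avoidersS 3?big_nat_recl // subn0 subn1 subn2.
rewrite (eq_bigr (fun l => skew_avoiders 0 (n - l))); first last.
  by move=> l _; congr (skew_avoiders _ _); lia.
by rewrite -[3 - maxn 1 0]/2 -[3 - maxn 1 2]/1; rewrite /=; lia.
Qed.

Lemma skew_avoiders_n1 (k : nat) : skew_avoiders k.+1 1 = 1.
Proof. by rewrite skew_avoidersS big_nil skew_avoiders_n0. Qed.

Lemma skew_avoiders_n2 (k : nat) : skew_avoiders k.+2 2 = 2.
Proof. by rewrite skew_avoidersS big_nat1 subn1 !skew_avoiders_n1. Qed.

Lemma skew_avoiders33 : skew_avoiders 3 3 = 5.
Proof.
rewrite skew_avoidersS 2?big_nat_recl // big_nil subn0 subn1.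
rewrite -[3 - maxn 1 0]/2.
by rewrite !skew_avoiders_n1 !skew_avoiders_n2.
Qed.

Lemma skew_avoiders2E (n : nat) :
  skew_avoiders 2 n.+2 + 2 * 'C(n.+2, 3) + 6 * 'C(n.+2, 2) + 7 * n.+2 + 17 =
  9 * fib n.+2 + 15 * fib n.+3.
Proof.
elim: n => [|n IHn]; first by rewrite skew_avoiders_n2.
have := skew_avoiders2S n; have := skew_avoiders1E n.+2; have := skew_avoiders1E n.+1.
rewrite !binS !bin1 !bin0 !fibSS in IHn *; lia.
Qed.

Lemma skew_avoiders3E (n : nat) :
  skew_avoiders 3 n.+2 + 4 * 'C(n.+3, 4) + 7 * 'C(n.+3, 3) + 5 * 'C(n.+3, 2)
    + 27 * 'C(n.+3, 1) + 8 =
  5 * fib n.+4.+4 + fib n.+4.+2.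
Proof.
(* The recurrence for [k = 3] starts at size 4, so sizes 2 and 3 are checked directly. *)
case: n => [|n]; first by rewrite skew_avoiders_n2.
elim: n => [|n IHn]; first by rewrite skew_avoiders33.
have := skew_avoiders3S n; have := skew_avoiders2E n.+1; have := skew_avoiders2E n.
have := skew_avoiders1E n.+1.
rewrite !binS !bin1 !bin0 !fibSS in IHn *; lia.
Qed.

(** * Products and quotients of formal power series *)

Import GRing.Theory.
Local Open Scope ring_scope.

Section PowerSeriesDivision.
Variable K : fieldType.
Implicit Types a b c : fps K.

(** A coefficient below [N] depends only on the truncations at [N]; commutativity and associativity
    are thereby inherited from polynomials. *)
Lemma fps_mulE a b N n : (n < N)%N ->
  fps_mul a b n = ((\poly_(i < N) a i) * (\poly_(i < N) b i))`_n.
Proof.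
move=> lt_nN; rewrite coefM; apply: eq_bigr => i _.
by rewrite !coef_poly !ifT //; have := ltn_ord i; lia.
Qed.

Lemma eq_fps_mul a a' b b' : a =1 a' -> b =1 b' -> fps_mul a b =1 fps_mul a' b'.
Proof. by move=> eq_a eq_b n; apply: eq_bigr => i _; rewrite eq_a eq_b. Qed.

Lemma fps_mulC a b : fps_mul a b =1 fps_mul b a.
Proof. by move=> n; rewrite !(fps_mulE _ _ (ltnSn n)) mulrC. Qed.

Lemma fps_mulA a b c : fps_mul a (fps_mul b c) =1 fps_mul (fps_mul a b) c.
Proof.
move=> n; pose p (d : fps K) := \poly_(i < n.+1) d i.
have pE d i : (i < n.+1)%N -> d i = (p d)`_i by move=> lt_i; rewrite coef_poly lt_i.
transitivity (p a * (p b * p c))`_n.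
  rewrite coefM; apply: eq_bigr => i _; rewrite -pE ?ltn_ord //; congr (_ * _).
  by apply: fps_mulE; have := ltn_ord i; lia.
rewrite mulrA coefM; apply: eq_bigr => i _; rewrite -(fps_mulE _ _ (ltn_ord i)).
by rewrite -(pE c) //; lia.
Qed.

Lemma fps_mul1 a : fps_mul a (fps_of_poly 1) =1 a.
Proof.
move=> n; rewrite /fps_mul big_ord_recr /= subnn big1 ?add0r ?/fps_of_poly ?coef1 ?mulr1 //.
by move=> i _; rewrite coef1 (_ : (n - i == 0)%N = false) ?mulr0 //; have := ltn_ord i; lia.
Qed.

Lemma fps_div_unique a b c : b 0%N != 0 -> fps_mul a b =1 c -> a =1 fps_div c b.
Proof.
move=> b0 ab n; rewrite /fps_div -(eq_fps_mul ab (fun=> erefl)) -fps_mulA.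
rewrite (eq_fps_mul (fun=> erefl) (fps_mulC _ _)).
by rewrite (eq_fps_mul (fun=> erefl) (fps_mulVq b0)) fps_mul1.
Qed.

End PowerSeriesDivision.

(** * The generating function *)

(** The coefficients are those of the denominator, split between the two sides by sign. Size [n + 9]
    lies just beyond the degree 8 of the numerator, and the smallest size, [n + 2], is within reach
    of the closed formula. *)
Lemma skew_avoiders3_rec (n : nat) :
  (skew_avoiders 3 n.+4.+4.+1 + 14 * skew_avoiders 3 n.+4.+3 +
   5 * skew_avoiders 3 n.+4.+1 + 4 * skew_avoiders 3 n.+4 + skew_avoiders 3 n.+2 =
   6 * skew_avoiders 3 n.+4.+4 + 15 * skew_avoiders 3 n.+4.+2 +
   4 * skew_avoiders 3 n.+3)%N.
Proof.
have := skew_avoiders3E n; have := skew_avoiders3E n.+1.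
have := skew_avoiders3E n.+2; have := skew_avoiders3E n.+3.
have := skew_avoiders3E n.+4; have := skew_avoiders3E n.+4.+1.
have := skew_avoiders3E n.+4.+2; have := skew_avoiders3E n.+4.+3.
(* Expanding all binomials at [m] and adding instances of the Fibonacci recurrence leaves a linear
   problem. *)
move: n.+2 => m; rewrite !binS !bin1 !bin0.
have := fibSS m.+4; have := fibSS m.+4.+1.
have := fibSS m.+4.+2; have := fibSS m.+4.+3.
have := fibSS m.+4.+4; have := fibSS m.+4.+4.+1.
have := fibSS m.+4.+4.+2; have := fibSS m.+4.+4.+3.
by lia.
Qed.

Lemma denominatorE :
  ('X^2 + 'X - 1) * (1 - 'X) ^+ 5 =
  Poly [:: -1; 6; -14; 15; -5; -4; 4; -1] :> {poly rat}.
Proof. by rewrite /Poly /= !cons_poly_def; ring. Qed.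

Lemma numeratorE :
  2 *: 'X^8 - 'X^7 - 'X^6 - 5 *: 'X^5 - 'X^4 + 8 *: 'X^3 - 10 *: 'X^2 + 5 *: 'X - 1 =
  Poly [:: -1; 5; -10; 8; -1; -5; -1; -1; 2] :> {poly rat}.
Proof. by rewrite /Poly /= !cons_poly_def -!mul_polyC; ring. Qed.

Lemma skew_avoiders3_values :
  [seq skew_avoiders 3 i | i <- iota 0 9] = [:: 1; 1; 2; 5; 13; 34; 88; 218; 506]%N.
Proof.
(* The truncated subtraction is exact by the closed formula, and the right-hand side can be
   computed. *)
have E n : skew_avoiders 3 n.+2 = (5 * fib n.+4.+4 + fib n.+4.+2 - (4 * 'C(n.+3, 4)
    + 7 * 'C(n.+3, 3) + 5 * 'C(n.+3, 2) + 27 * 'C(n.+3, 1) + 8))%N.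
  by have := skew_avoiders3E n; lia.
by rewrite /= skew_avoiders_n0 skew_avoiders_n1 !E.
Qed.

Lemma fps_mul_denominator (a : nat -> nat) :
  [seq a i | i <- iota 0 9] = [:: 1; 1; 2; 5; 13; 34; 88; 218; 506]%N ->
  (forall n, a n.+4.+4.+1 + 14 * a n.+4.+3 + 5 * a n.+4.+1 + 4 * a n.+4 + a n.+2 =
             6 * a n.+4.+4 + 15 * a n.+4.+2 + 4 * a n.+3)%N ->
  fps_mul (fun n => (a n)%:R : rat)
    (fps_of_poly (Poly [:: -1; 6; -14; 15; -5; -4; 4; -1])) =1
  fps_of_poly (Poly [:: -1; 5; -10; 8; -1; -5; -1; -1; 2]).
Proof.
move=> [v0 v1 v2 v3 v4 v5 v6 v7 v8] a_rec n; rewrite fps_mulC /fps_mul /fps_of_poly.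
under eq_bigr do rewrite coef_Poly; rewrite coef_Poly.
have [lt_n9 | ge_n9] := ltnP n 9.
  case: n lt_n9 => [|[|[|[|[|[|[|[|[|n]]]]]]]]] // _;
    rewrite !big_ord_recl big_ord0 /bump /= ?subSS ?subn0 /=;
    rewrite ?(v0, v1, v2, v3, v4, v5, v6, v7, v8); lra.
have -> : n = (n - 9).+4.+4.+1 by lia.
(* The denominator has degree 7, so eight terms of the convolution remain; the recurrence cancels
   them, as the numerator has no coefficient here. *)
move: (n - 9)%N => {ge_n9}n; rewrite [RHS]nth_default // 8!big_ord_recl big1 => [|i _]. 
  have /(congr1 (fun k => k%:R : rat)) := a_rec n.
  rewrite !(natrD, natrM) /= => rec_n; rewrite /bump /= !subSS !subn0; lra.
by rewrite nth_default ?mul0r.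
Qed.

Theorem theorem4p12 :
  (forall n : nat, (2 <= n)%N ->
     #|avoiders n [:: p132; p654213; p2341]|%:Z =
       5 * (fib (n + 6))%:Z + (fib (n + 4))%:Z
       - 4 * 'C(n + 1, 4)%:Z - 7 * 'C(n + 1, 3)%:Z
       - 5 * 'C(n + 1, 2)%:Z - 27 * 'C(n + 1, 1)%:Z - 8)
  /\
  (fun n : nat => #|avoiders n [:: p132; p654213; p2341]|%:R : rat) =1
    fps_div
      (fps_of_poly
         (2 *: 'X^8 - 'X^7 - 'X^6 - 5 *: 'X^5 - 'X^4 + 8 *: 'X^3
          - 10 *: 'X^2 + 5 *: 'X - 1))
      (fps_of_poly (('X^2 + 'X - 1) * (1 - 'X) ^+ 5)).
Proof.
split=> [[|[|n]] // _ | n]; rewrite card_avoiders.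
  have e6 : (n.+2 + 6)%N = n.+4.+4 by rewrite !addnS addn0.
  have e4 : (n.+2 + 4)%N = n.+4.+2 by rewrite !addnS addn0.
  have := skew_avoiders3E n.
  by rewrite e6 e4 addn1; lia.
rewrite denominatorE numeratorE.
have den0 : fps_of_poly (Poly [:: -1; 6; -14; 15; -5; -4; 4; -1] : {poly rat}) 0%N != 0.
  by rewrite /fps_of_poly coef_Poly.
exact: (fps_div_unique den0 (fps_mul_denominator skew_avoiders3_values skew_avoiders3_rec)).
Qed.
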